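(* Let $\underline{A},\overline{A}\in\mathbb{R}^{n\times n}$ with $\underline{A}\le\overline{A}$ (entrywise), let $\mathbf{A}=\{A\in\mathbb{R}^{n\times n} : \underline{A}\le A\le\overline{A}\}$, and let $A^c=\frac12(\underline{A}+\overline{A})$. Assume that $A^c$ is an $M$-matrix. Then $\mathbf{A}$ is strongly principally nondegenerate if and only if $\mathbf{A}$ is strongly an $H$-matrix.
   Context: A matrix property holds strongly for an interval matrix $\mathbf{A}$ if it holds for every $A\in\mathbf{A}$. A matrix $A\in\mathbb{R}^{n\times n}$ is principally nondegenerate if all its principal minors are nonzero. A matrix $A\in\mathbb{R}^{n\times n}$ is an $M$-matrix if $A=sI_n-N$ for some entrywise nonnegative $N$ and $s\in\mathbb{R}$ with $s>\rho(N)$, where $\rho$ is the spectral radius. A matrix $A$ is an $H$-matrix if its comparison matrix $\langle A\rangle$, given by $\langle A\rangle_{ii}=|a_{ii}|$ and $\langle A\rangle_{ij}=-|a_{ij}|$ for $i\ne j$, is an $M$-matrix. *)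

(* Defs.v *)
From mathcomp Require Import all_boot all_order all_algebra.
From mathcomp Require Import complex.
From mathcomp Require Import all_classical all_reals.

Set Implicit Arguments.
Unset Strict Implicit.
Unset Printing Implicit Defensive.

Import Order.TTheory GRing.Theory Num.Theory.
Local Open Scope classical_set_scope.
Local Open Scope ring_scope.

Definition mx_le (R : realType) (m n : nat) (A B : 'M[R]_(m, n)) : Prop :=
  forall i j, A i j <= B i j.

Definition interval_mx (R : realType) (n : nat) (lA uA : 'M[R]_n) :
    set 'M[R]_n :=
  [set A | mx_le lA A /\ mx_le A uA].

Definition midpoint_mx (R : realType) (n : nat) (lA uA : 'M[R]_n) : 'M[R]_n :=
  2^-1 *: (lA + uA).

Definition strongly (R : realType) (n : nat) (P : 'M[R]_n -> Prop)
    (bA : set 'M[R]_n) : Prop :=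
  forall A, bA A -> P A.

Definition principal_submx (R : realType) (n : nat) (S : {set 'I_n})
    (A : 'M[R]_n) : 'M[R]_#|S| :=
  mxsub enum_val enum_val A.

(* The empty principal minor is 1, so including S = set0 is harmless. *)
Definition principally_nondegenerate (R : realType) (n : nat) (A : 'M[R]_n) :
    Prop :=
  forall S : {set 'I_n}, \det (principal_submx S A) != 0.

(* The eigenvalues are complex. For n > 0 the set is finite and nonempty, so
   the supremum is a maximum; for n = 0 it is empty and its sup is 0. *)
Definition spectral_radius (R : realType) (n : nat) (A : 'M[R]_n) : R :=
  sup [set ComplexField.Normc.normc l
      | l in [set l : R[i] | eigenvalue (map_mx (real_complex R) A) l]].

Definition M_matrix (R : realType) (n : nat) (A : 'M[R]_n) : Prop :=
  exists (s : R) (N : 'M[R]_n),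
    [/\ mx_le 0 N, spectral_radius N < s & A = s%:M - N].

Definition comparison_mx (R : realType) (n : nat) (A : 'M[R]_n) : 'M[R]_n :=
  \matrix_(i, j) (if i == j then `|A i j| else - `|A i j|).

Definition H_matrix (R : realType) (n : nat) (A : 'M[R]_n) : Prop :=
  M_matrix (comparison_mx A).

(* Main.v *)
(** Call [B] semipositive if [B x > 0] for some [x > 0].  A matrix with
    nonpositive off-diagonal entries is an M-matrix iff it is semipositive, and
    along a segment of nonsingular matrices of this kind semipositivity cannot be
    lost.  Since the off-diagonal entries of [A^c] are nonpositive,
    [lA <= comparison_mx A] for every [A] in the interval.  Nonsingularity
    on the segment from [A^c] to [lA] makes [lA] semipositive, hence every
    [comparison_mx A] as well.  Conversely, if [comparison_mx A] is semipositive,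
    so are its principal submatrices, which makes those of [A] diagonally
    dominant up to scaling, hence nonsingular. *)
Require Import Defs.
From mathcomp Require Import all_boot all_order all_algebra.
From mathcomp Require Import complex.
From mathcomp Require Import all_classical all_reals.
From mathcomp Require Import topology normedtype.
From mathcomp Require Import ring lra.

Set Implicit Arguments.
Unset Strict Implicit.
Unset Printing Implicit Defensive.

Import Order.TTheory GRing.Theory Num.Theory numFieldNormedType.Exports.
Local Open Scope ring_scope.

(** * Semipositive Z-matrices and paths of them *)

Definition mx_pos (R : realType) (n : nat) (x : 'cV[R]_n) : Prop :=
  forall i, 0 < x i 0.

Definition Z_matrix (R : realType) (n : nat) (B : 'M[R]_n) : Prop :=
  forall i j, i != j -> B i j <= 0.

Definition semipositive (R : realType) (n : nat) (B : 'M[R]_n) : Prop :=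
  exists2 x : 'cV[R]_n, mx_pos x & mx_pos (B *m x).

(* If positivity were lost along the path, then by the intermediate value
   theorem the smallest entry of some [y c] would be zero, and the corresponding
   row of [B c *m y c] would be nonpositive. *)
Lemma mx_pos_path (R : realType) (n : nat) (B : R -> 'M[R]_n)
    (y : R -> 'cV[R]_n) :
  (forall t, 0 <= t <= 1 -> Z_matrix (B t)) ->
  (forall i, continuous (fun t => y t i 0)) ->
  (forall t, 0 <= t <= 1 -> mx_pos (B t *m y t)) ->
  mx_pos (y 0) -> mx_pos (y 1).
Proof.
move=> BZ yc By y0 i; rewrite ltNge; apply/negP => yi1.
pose f t := \big[Order.min/1]_j y t j 0.
have f0 : 0 < f 0 by apply: lt_bigmin.
have f1 : f 1 <= 0 by apply: le_trans yi1; exact: bigmin_le.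
have fc : continuous f.
  by apply: continuous_big => // -[a b]; exact: min_continuous.
have [] := @IVT R f 0 1 0 ler01 (continuous_subspaceT fc).
  by rewrite ge_min f1 orbT le_max (ltW f0).
move=> c; rewrite in_itv /= => c01 fc0.
have yge0 j : 0 <= y c j 0 by rewrite -fc0; exact: bigmin_le.
have /bigmin_leP[|[k _ yk]] : f c <= 0 by rewrite fc0.
  by rewrite leNgt ltr01.
have := By c c01 k; rewrite mxE ltNge => /negP; apply.
apply: sumr_le0 => j _; have [->|jk] := eqVneq j k.
  by rewrite (@le_anti _ _ (y c k 0) 0) ?mulr0 // yk yge0.
by apply: mulr_le0_ge0 => //; apply: BZ; rewrite // eq_sym.
Qed.

(** On the segment from the witness [x] to [y], the image under [B] is a convex combination of two
    positive vectors, so [mx_pos_path] applies with a constant matrix. *)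
Lemma Z_semipositive_monotone (R : realType) (n : nat) (B : 'M[R]_n)
    (y : 'cV[R]_n) :
  Z_matrix B -> semipositive B -> mx_pos (B *m y) -> mx_pos y.
Proof.
move=> BZ [x x0 Bx] By.
pose z (t : R) := (1 - t) *: x + t *: y.
have z1 : z 1 = y by rewrite /z subrr scale0r add0r scale1r.
rewrite -z1; apply: (@mx_pos_path _ _ (fun=> B)) => //.
- move=> i t; rewrite /z.
  under eq_fun do rewrite !mxE.
  apply: cvgD; apply: cvgM; try exact: cvg_cst; last exact: cvg_id.
  by apply: cvgB; [exact: cvg_cst|exact: cvg_id].
- move=> t /andP[t0 t1] i; rewrite mulmxDr -!scalemxAr !mxE.
  have := Bx i; have := By i; rewrite !mxE.
  nra.
- by move=> i; rewrite /z subr0 scale1r scale0r addr0.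
Qed.

Lemma continuous_det (R : realType) (n : nat) (M : R -> 'M[R]_n) :
  (forall i j, continuous (fun t => M t i j)) ->
  continuous (fun t => \det (M t)).
Proof.
move=> Mc; rewrite /determinant.
apply: continuous_big => [|s _ t]; first exact: add_continuous.
apply: cvgM; first exact: cvg_cst.
by apply: continuous_big => // ; exact: mul_continuous.
Qed.

Lemma Z_semipositive_segment (R : realType) (n : nat) (B C : 'M[R]_n) :
  Z_matrix B -> Z_matrix C -> semipositive B ->
  (forall t, 0 <= t <= 1 -> \det ((1 - t) *: B + t *: C) != 0) ->
  semipositive C.
Proof.
move=> BZ CZ Bsp det0.
pose M (t : R) := (1 - t) *: B + t *: C.
have M0 : M 0 = B by rewrite /M subr0 scale1r scale0r addr0.
have M1 : M 1 = C by rewrite /M subrr scale0r add0r scale1r.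
have Mc i j : continuous (fun t => M t i j).
  move=> t; rewrite /M.
  under eq_fun do rewrite !mxE.
  apply: cvgD; apply: cvgM; try exact: cvg_cst; last exact: cvg_id.
  by apply: cvgB; [exact: cvg_cst|exact: cvg_id].
(* The adjugate keeps the entries continuous in [t], and [M t *m y t] has all entries equal to the
   square of [\det (M t)]. *)
pose y (t : R) : 'cV_n := \det (M t) *: (\adj (M t) *m const_mx 1).
have My t : 0 <= t <= 1 -> mx_pos (M t *m y t).
  move=> t01 i; rewrite /y -scalemxAr mulmxA mul_mx_adj mul_scalar_mx !mxE mulr1.
  by rewrite -expr2 exprn_even_gt0 //= det0.
have t0 : 0 <= (0 : R) <= 1 by rewrite lexx ler01.
have t1 : 0 <= (1 : R) <= 1 by rewrite lexx ler01.
exists (y 1); last by rewrite -M1; exact: My.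
apply: (@mx_pos_path _ _ M) => //.
- move=> t /andP[t_ge0 t_le1] i j ij; rewrite !mxE.
  have := BZ i j ij; have := CZ i j ij; nra.
- move=> i t; rewrite /y.
  under eq_fun do rewrite !mxE.
  apply: cvgM; first exact: continuous_det.
  apply: continuous_big => [|j _ u]; first exact: add_continuous.
  under eq_fun do rewrite !mxE.
  apply: cvgM; last exact: cvg_cst.
  apply: cvgM; first exact: cvg_cst.
  apply: continuous_det => k l v.
  by under eq_fun do rewrite 2!mxE; exact: Mc.
- by apply: (@Z_semipositive_monotone _ _ B) => //; rewrite -M0; exact: My.
Qed.

(** * Spectral bounds and M-matrices *)

Lemma sumr_norm_gt0 (C : numFieldType) (n : nat) (v : 'rV[C]_n)
    (x : 'cV[C]_n) :
  v != 0 -> (forall i, 0 < x i 0) -> 0 < \sum_i `|v 0 i| * x i 0.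
Proof.
move=> v0 x0; rewrite lt_def sumr_ge0 ?andbT; last first.
  by move=> i _; rewrite mulr_ge0 // ltW.
apply: contra v0 => /eqP s0; apply/eqP/rowP => i; rewrite mxE; apply/eqP.
have := @psumr_eq0P _ _ _ _ _ s0 i isT.
move=> /(_ (fun i _ => mulr_ge0 (normr_ge0 _) (ltW (x0 i)))) /eqP.
by rewrite mulf_eq0 normr_eq0 (gt_eqF (x0 i)) orbF.
Qed.

(** For a left eigenvector [v], pair [|v|] with [x]: the triangle inequality on [v *m N] gives
    [|l| * (|v| x) <= |v| N x <= r * (|v| x)], and [|v| x > 0]. *)
Lemma eigenvalue_weighted_bound (C : numFieldType) (n : nat) (N : 'M[C]_n)
    (x : 'cV[C]_n) (r l : C) :
  (forall i j, 0 <= N i j) -> (forall i, 0 < x i 0) ->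
  (forall i, (N *m x) i 0 <= r * x i 0) -> eigenvalue N l -> `|l| <= r.
Proof.
move=> N0 x0 Nx /eigenvalueP[v vN v0].
have S0 := sumr_norm_gt0 v0 x0.
rewrite -(ler_pM2r S0) !mulr_sumr.
apply: (@le_trans _ _ (\sum_j \sum_i `|v 0 i| * (N i j * x j 0))).
  apply: ler_sum => j _; rewrite mulrA -normrM.
  have -> : l * v 0 j = \sum_i v 0 i * N i j.
    by have /rowP/(_ j) := vN; rewrite !mxE => ->.
  under [leRHS]eq_bigr do rewrite mulrA.
  rewrite -mulr_suml ler_wpM2r ?(ltW (x0 j)) //.
  apply: le_trans (ler_norm_sum _ _ _) _.
  by apply: ler_sum => i _; rewrite normrM (ger0_norm (N0 _ _)).
rewrite exchange_big; apply: ler_sum => i _ /=.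
rewrite -mulr_sumr mulrCA ler_wpM2l //.
by have := Nx i; rewrite mxE.
Qed.

Lemma normcE_real (R : rcfType) (l : R[i]) (r : R) :
  (ComplexField.Normc.normc l <= r) = (`|l| <= r%:C%C).
Proof. by rewrite -lecR. Qed.

Lemma normc_eigenvalue_le (R : realType) (n : nat) (N : 'M[R]_n)
    (x : 'cV[R]_n) (r : R) (l : R[i]) :
  mx_le 0 N -> mx_pos x -> (forall i, (N *m x) i 0 <= r * x i 0) ->
  eigenvalue (map_mx (real_complex R) N) l -> ComplexField.Normc.normc l <= r.
Proof.
move=> N0 x0 Nx le; rewrite normcE_real.
apply: (eigenvalue_weighted_bound (x := map_mx (real_complex R) x)) le.
- by move=> i j; rewrite mxE lecR; have := N0 i j; rewrite mxE.
- by move=> i; rewrite mxE ltcR.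
- by move=> i; rewrite -map_mxM !mxE -rmorphM /= lecR; have := Nx i; rewrite mxE.
Qed.

Lemma sum_row_le (R : realType) (n : nat) (N : 'M[R]_n) (i : 'I_n) :
  mx_le 0 N -> \sum_j N i j <= \sum_k \sum_j N k j.
Proof.
move=> N0; rewrite [leRHS](bigD1 i) //= lerDl.
by apply: sumr_ge0 => k _; apply: sumr_ge0 => j _; have := N0 k j; rewrite mxE.
Qed.

Lemma real_eigenvalue_le_spectral_radius (R : realType) (n : nat) (N : 'M[R]_n)
    (l : R) :
  mx_le 0 N -> eigenvalue N l -> `|l| <= spectral_radius N.
Proof.
move=> N0 /eigenvalueP[v vN v0].
apply: ub_le_sup.
  (* The supremum dominates only if the set is bounded: weight [const_mx 1] bounds all eigenvalues
     by the sum of all entries. *)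
  exists (\sum_k \sum_j N k j) => _ [m mN <-].
  apply: (@normc_eigenvalue_le _ _ N (const_mx 1)) mN => // i; rewrite !mxE //.
  rewrite mulr1; under eq_bigr do rewrite mxE mulr1.
  exact: sum_row_le.
exists (l%:C%C); last by rewrite /= expr0n addr0 sqrtr_sqr.
apply/eigenvalueP; exists (map_mx (real_complex R) v); last by rewrite map_mx_eq0.
by rewrite -map_mxM vN map_mxZ.
Qed.

Lemma M_matrix_semipositive (R : realType) (n : nat) (B : 'M[R]_n) :
  M_matrix B -> Z_matrix B /\ semipositive B.
Proof.
case=> s [N [N0 rho ->]].
have N_ge0 i j : 0 <= N i j by have := N0 i j; rewrite mxE.
have Z a : Z_matrix (a%:M - N).
  by move=> i j ij; rewrite !mxE (negbTE ij) mulr0n sub0r oppr_le0.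
(* This [K] makes the row sums of [(s + K)%:M - N] at least 1. Along the segment down to [s%:M - N],
   the shift [l] stays at least [s], hence above every real eigenvalue of [N]. *)
split=> //; pose K := `|s| + \sum_k \sum_j N k j + 1.
apply: (@Z_semipositive_segment _ _ ((s + K)%:M - N)) => //.
  exists (const_mx 1) => i; rewrite ?mulmxBl ?mul_scalar_mx !mxE //.
  under eq_bigr do rewrite mxE mulr1.
  have := sum_row_le i N0; have := ler_norm (- s); rewrite normrN /K; lra.
move=> t /andP[t0 t1]; set l := s + (1 - t) * K.
have -> : (1 - t) *: ((s + K)%:M - N) + t *: (s%:M - N) = l%:M - N.
  apply/matrixP => i j; rewrite !mxE /l.
  by case: (i == j); rewrite ?mulr1n ?mulr0n; ring.
have K0 : 0 <= K.
  by rewrite !addr_ge0 // sumr_ge0 // => k _; rewrite sumr_ge0.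
have sl : s <= l by rewrite lerDl mulr_ge0 // subr_ge0.
apply/det0P => -[v v0 /eqP]; rewrite mulmxBr mul_mx_scalar subr_eq0 => /eqP vl.
have : eigenvalue N l by apply/eigenvalueP; exists v.
move=> /(real_eigenvalue_le_spectral_radius N0).
have := ler_norm l; lra.
Qed.

(** With [N = s%:M - B] and the witness [x] as weight, [N x <= (s - e) x] for some [e > 0], so the
    spectral radius is at most [s - e], unless there are no eigenvalues. *)
Lemma semipositive_M_matrix (R : realType) (n : nat) (B : 'M[R]_n) :
  Z_matrix B -> semipositive B -> M_matrix B.
Proof.
move=> BZ [x x0 Bx]; pose s := 1 + \sum_i `|B i i|.
have s_gt0 : 0 < s by rewrite ltr_pwDl // sumr_ge0.
exists s, (s%:M - B); have N0 : mx_le 0 (s%:M - B).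
  move=> i j; rewrite !mxE; have [<-|ij] := eqVneq i j.
    rewrite mulr1n subr_ge0 /s (bigD1 i) //=.
    have : 0 <= \sum_(k < n | k != i) `|B k k| by rewrite sumr_ge0.
    have := ler_norm (B i i); lra.
  by rewrite mulr0n sub0r oppr_ge0; exact: BZ.
split=> //; last by rewrite opprB addrC subrK.
pose e := \big[Order.min/1]_i ((B *m x) i 0 / x i 0).
have e0 : 0 < e by apply: lt_bigmin => // i _; rewrite divr_gt0.
rewrite /spectral_radius; set E := (X in sup X).
(* If there are no eigenvalues, as for [n = 0], the supremum is 0 and [s > 0] suffices. *)
have [->|/set0P Ene] := eqVneq E set0; first by rewrite sup0.
apply: (@le_lt_trans _ _ (s - e)); last by rewrite ltrBlDr ltrDl.
apply: ge_sup => // _ [l lN <-].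
apply: normc_eigenvalue_le lN => // i.
rewrite mulmxBl mul_scalar_mx mulrBl mxE [X in X + _]mxE [X in _ + X]mxE.
rewrite lerD2l lerN2 -ler_pdivlMr //.
exact: bigmin_le.
Qed.

(** * Comparison matrices and principal submatrices *)

Lemma comparison_mx_Z (R : realType) (n : nat) (A : 'M[R]_n) :
  Z_matrix (comparison_mx A).
Proof. by move=> i j ij; rewrite mxE (negbTE ij) oppr_le0. Qed.

Lemma comparison_principal_submx (R : realType) (n : nat) (S : {set 'I_n})
    (A : 'M[R]_n) :
  comparison_mx (principal_submx S A) = principal_submx S (comparison_mx A).
Proof.
by apply/matrixP => i j; rewrite !mxE (inj_eq enum_val_inj).
Qed.

(** Restrict [x] to [S]: in a row of [S], the dropped columns are off-diagonal and contribute
    nonpositive terms. *)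
Lemma Z_semipositive_principal_submx (R : realType) (n : nat)
    (S : {set 'I_n}) (B : 'M[R]_n) :
  Z_matrix B -> semipositive B -> semipositive (principal_submx S B).
Proof.
move=> BZ [x x0 Bx]; exists (\col_i x (enum_val i) 0) => i; rewrite mxE //.
have := Bx (enum_val i); rewrite mxE => /lt_le_trans; apply.
rewrite (bigID (mem S)) /= -[leRHS]addr0 lerD //.
  by rewrite big_enum_val /=; apply: ler_sum => j _; rewrite !mxE.
apply: sumr_le0 => j jS; rewrite mulr_le0_ge0 //; last exact: ltW.
by apply: BZ; apply: contraNneq jS => <-; exact: enum_valP.
Qed.

(* A left kernel vector [v] of [A] satisfies [|v| *m comparison_mx A <= 0]
   entrywise, which pairing with [x] contradicts. *)
Lemma semipositive_comparison_det (R : realType) (n : nat) (A : 'M[R]_n) :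
  semipositive (comparison_mx A) -> \det A != 0.
Proof.
case=> x x0 Cx; apply/det0P => -[v v0 vA].
have := sumr_norm_gt0 v0 Cx; rewrite ltNge => /negP; apply.
under eq_bigr do rewrite mxE mulr_sumr.
rewrite exchange_big /=; apply: sumr_le0 => j _.
under eq_bigr do rewrite mulrA.
rewrite -mulr_suml mulr_le0_ge0 //; last exact: ltW.
rewrite (bigD1 j) //= mxE eqxx -normrM.
have /rowP/(_ j) := vA; rewrite !mxE (bigD1 j) //= => /eqP.
rewrite addr_eq0 => /eqP ->; rewrite normrN -lerBrDr sub0r.
apply: le_trans (ler_norm_sum _ _ _) _; rewrite -sumrN; apply: ler_sum => i ij.
by rewrite mxE (negbTE ij) mulrN opprK normrM.
Qed.

Lemma H_matrix_principally_nondegenerate (R : realType) (n : nat)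
    (A : 'M[R]_n) : H_matrix A -> principally_nondegenerate A.
Proof.
move=> /M_matrix_semipositive[CZ Csp] S.
apply: semipositive_comparison_det; rewrite comparison_principal_submx.
exact: Z_semipositive_principal_submx.
Qed.

Lemma semipositive_le (R : realType) (n : nat) (B C : 'M[R]_n) :
  mx_le B C -> semipositive B -> semipositive C.
Proof.
move=> BC [x x0 Bx]; exists x => // i; apply: lt_le_trans (Bx i) _.
by rewrite !mxE; apply: ler_sum => j _; rewrite ler_wpM2r ?BC // ltW.
Qed.

(** For the full index set the principal submatrix is [A] only up to renumbering by [enum_val], so a
    left kernel vector is transported. *)
Lemma principally_nondegenerate_det (R : realType) (n : nat) (A : 'M[R]_n) :
  principally_nondegenerate A -> \det A != 0.
Proof.
move=> /(_ [set: 'I_n]); apply: contra => /det0P[v v0 vA].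
apply/det0P; exists (\row_i v 0 (enum_val i)).
  apply: contra v0 => /eqP/rowP w0; apply/eqP/rowP => i.
  have iT : i \in [set: 'I_n] by rewrite inE.
  by have := w0 (enum_rank_in iT i); rewrite !mxE enum_rankK_in.
apply/rowP => j; have /rowP/(_ (enum_val j)) := vA; rewrite !mxE => vAj.
rewrite -[RHS]vAj [RHS](eq_bigl [in [set: 'I_n]]); last by move=> i; rewrite inE.
by rewrite [RHS]big_enum_val; apply: eq_bigr => i _; rewrite !mxE.
Qed.

Theorem proposition8 (R : realType) (n : nat) (lA uA : 'M[R]_n)
    (hle : mx_le lA uA) (hM : M_matrix (midpoint_mx lA uA)) :
  strongly (@principally_nondegenerate R n) (interval_mx lA uA) <->
  strongly (@H_matrix R n) (interval_mx lA uA).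
Proof.
split=> [nd A [lA_A A_uA]|H A /H]; last exact: H_matrix_principally_nondegenerate.
have [cZ csp] := M_matrix_semipositive hM.
have lZ : Z_matrix lA.
  by move=> i j ij; have := cZ i j ij; have := hle i j; rewrite !mxE; lra.
have lsp : semipositive lA.
  apply: Z_semipositive_segment csp _ => // t /andP[t0 t1].
  apply/principally_nondegenerate_det/nd.
  by split=> i j; have := hle i j; rewrite !mxE; nra.
apply: semipositive_M_matrix; first exact: comparison_mx_Z.
apply: semipositive_le lsp => i j; rewrite mxE; case: eqVneq => [->|ij].
  exact: le_trans (ler_norm _).
(* Off the diagonal, [A <= uA <= - lA], since [lA + uA] is twice a nonpositive entry of the
   midpoint. *)
rewrite lerNr ler_norml opprK lA_A /=.
by have := A_uA i j; have := cZ i j ij; rewrite !mxE; lra.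
Qed.
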